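(* Let $H$ be a real Hilbert space and $f:H\to\mathbb{R}\cup\{+\infty\}$ a lower semicontinuous proper convex function with $\inf f=0$. The following statements are equivalent: (i) There exist $r_0>0$ and $\varphi\in\mathcal{K}(0,r_0)$ such that $\|\partial(\varphi\circ f)(x)\|_-\ge1$ for all $x\in[0<f\le r_0]$. (ii) There exists a concave function $\psi\in\mathcal{K}(0,\infty)$ such that $\|\partial(\psi\circ f)(x)\|_-\ge1$ for all $x\notin[f=0]$.
   Context: $\partial g$ denotes the Fréchet subdifferential: $p\in\partial g(x)$ ($x\in\operatorname{dom}g$) iff $\liminf_{y\to x,y\ne x}\frac{g(y)-g(x)-\langle p,y-x\rangle}{\|y-x\|}\ge0$, and $\partial g(x)=\emptyset$ outside $\operatorname{dom}g$. $\|C\|_-=\inf\{\|p\|:p\in C\}$, equal to $+\infty$ if $C=\emptyset$. $\mathcal{K}(0,\bar r)$ ($\bar r\in(0,+\infty]$): functions $\varphi\in C([0,\bar r))\cap C^1(0,\bar r)$ with $\varphi(0)=0$ and $\varphi'>0$ on $(0,\bar r)$. $[0<f\le r_0]=\{x:0<f(x)\le r_0\}$. *)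

(* Defs.v *)
From HB Require Import structures.
From mathcomp Require Import all_boot all_order all_algebra.
From mathcomp Require Import all_classical all_reals all_analysis.
Set Implicit Arguments. Unset Strict Implicit. Unset Printing Implicit Defensive.
Import Order.TTheory GRing.Theory Num.Theory.
Import numFieldNormedType.Exports.
Local Open Scope classical_set_scope.
Local Open Scope ring_scope.

(* A real Hilbert space: a complete normed space V over R together with an
   inner product [inner] whose induced norm is the norm of V. *)
Definition is_inner_product (R : realType) (V : completeNormedModType R)
    (inner : V -> V -> R) : Prop :=
  [/\ (forall x y, inner x y = inner y x),
      (forall a x y z, inner (a *: x + y) z = a * inner x z + inner y z),
      (forall x, 0 <= inner x x) &
      (forall x, `|x| = Num.sqrt (inner x x))].

Section defs.
Context {R : realType} {V : completeNormedModType R}.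
Local Open Scope ereal_scope.

Definition proper_fun (f : V -> \bar R) : Prop :=
  (forall x, f x != -oo) /\ (exists x, f x \is a fin_num).

Definition convex_efun (f : V -> \bar R) : Prop :=
  forall (x y : V) (t : R), (0 <= t <= 1)%R -> f x < +oo -> f y < +oo ->
    f (t *: x + (1 - t) *: y)%R <= t%:E * f x + (1 - t)%R%:E * f y.

Definition frechet_subdiff (inner : V -> V -> R) (g : V -> \bar R) (x : V)
  : set V :=
  [set p | g x \is a fin_num /\
     0 <= limf_einf
       (fun y : V => (g y - g x - (inner p (y - x)%R)%:E) * ((`|(y - x)%R|)^-1)%:E)
       (x^' : set_system V)].

(* ||C||_- = inf of norms, +oo if C is empty *)
Definition inf_norm (C : set V) : \bar R :=
  ereal_inf [set (`|p|)%:E | p in C].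

(* phi o f, for phi defined on [0, rbar): equal to +oo where f x is
   outside [0, rbar) (so such points lie outside the domain). *)
Definition compK (rbar : \bar R) (phi : R -> R) (f : V -> \bar R) : V -> \bar R :=
  fun x => if (0 <= f x) && (f x < rbar) then (phi (fine (f x)))%:E else +oo.

End defs.

Definition classK {R : realType} (rbar : \bar R) (phi : R -> R) : Prop :=
  [/\ {within [set t : R | 0 <= t /\ (t%:E < rbar)%E], continuous phi},
      phi 0 = 0 &
      forall t : R, 0 < t -> (t%:E < rbar)%E ->
        [/\ derivable phi t 1, {for t, continuous (derive1 phi)} & 0 < (derive1 phi) t]].

Definition concave_on_nonneg {R : realType} (psi : R -> R) : Prop :=
  forall s t l : R, 0 <= s -> 0 <= t -> 0 <= l <= 1 ->
    l * psi s + (1 - l) * psi t <= psi (l * s + (1 - l) * t).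

(* Main.v *)
Require Import Defs.
From HB Require Import structures.
From mathcomp Require Import all_boot all_order all_algebra.
From mathcomp Require Import all_classical all_reals all_analysis.
From mathcomp Require Import ring lra.
Import Order.TTheory GRing.Theory Num.Theory.
Import numFieldNormedType.Exports.
Local Open Scope classical_set_scope.
Local Open Scope ring_scope.

(* Let [p] be a subgradient of [f] at [x] and [0 < s < f x]. Projecting [x] onto
   the sublevel set [f <= s] gives a point of level [s] carrying a subgradient
   no longer than [p]. By the chain rule, the hypothesis on [phi] says that
   [phi' (f y) * |q| >= 1] for every subgradient [q] of [f] at a point [y] of
   small positive level, so [phi' s * |p| >= 1] for all small [s <= f x].
   Hence [phi'] may be replaced by its running infimum [w] over [(0, r]], frozen
   beyond some level [r1]: it is continuous, nonincreasing, still satisfies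
   [w (f x) * |p| >= 1], and is integrable at [0] because [w <= phi']. Its
   primitive vanishing at [0] is the concave [psi]. *)

(** * Derivatives and primitives of functions of one real variable *)

Lemma is_derive_continuous (R : realType) (f : R -> R) (t d : R) :
  is_derive t 1 f d -> {for t, continuous f}.
Proof.
move=> [df _]; apply: differentiable_continuous; exact/derivable1_diffP.
Qed.

Lemma is_derive_expansion (R : realType) (f : R -> R) (t d : R) :
  is_derive t 1 f d -> forall e : R, 0 < e ->
  \forall s \near t, `|f s - f t - d * (s - t)| <= e * `|s - t|.
Proof.
move=> [df <-] e e0.
have /cvgrPdist_le/(_ e e0) : h^-1 *: ((f \o shift t) (h *: 1) - f t)
    @[h --> 0^'] --> 'D_1 f t by exact: df.
rewrite nearE /= /dnbhs /within /= => -[r r0 rP]; exists r => //= s /= str.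
have [->|st] := eqVneq s t; first by rewrite !subrr mulr0 subrr normr0 mulr0.
have st0 : s - t != 0 by rewrite subr_eq0.
rewrite distrC in str.
have {rP} := rP (s - t); rewrite /= sub0r normrN => /(_ str st0).
rewrite /= [_ *: 1]mulr1 subrK => H.
have -> : f s - f t - 'D_1 f t * (s - t) =
    ((s - t)^-1 * (f s - f t) - 'D_1 f t) * (s - t) by field.
by rewrite normrM ler_wpM2r// distrC.
Qed.

Lemma near_eq_is_derive (R : realType) (f g : R -> R) (t d : R) :
  (\forall s \near t, f s = g s) -> is_derive t 1 g d -> is_derive t 1 f d.
Proof.
move=> fg [dg <-]; apply: DeriveDef; last exact: near_eq_derive.
by apply: near_eq_derivable dg; apply: filterS fg => s ->.
Qed.

Lemma is_derive0_eq (R : realType) (f : R -> R) (a x y : R) :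
  (forall t : R, a < t -> is_derive t 1 f 0) -> a < x -> a < y -> f x = f y.
Proof.
move=> df; wlog xy : x y / x < y.
  move=> H ax ay; have [xy|xy|->//] := ltgtP x y; first exact: H.
  by apply/esym; exact: H.
move=> ax ay.
have [||c _] := @MVT R f (fun=> 0) x y xy.
- by move=> t; rewrite in_itv/= => /andP[xt _]; exact/df/(lt_trans ax).
- apply: derivable_within_continuous => t; rewrite in_itv/= => /andP[xt _].
  by have [] := df t (lt_le_trans ax xt).
- by rewrite mul0r => /subr0_eq ->.
Qed.

(** Since [w] may fail to be integrable at 0, no integral starts there. Integrals from positive base
    points, each shifted to vanish at 1, agree wherever two of them are compared, and so glue into
    one primitive. *)
Lemma antiderivative_pos (R : realType) (w : R -> R) :
  (forall t : R, 0 < t -> {for t, continuous w}) ->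
  exists W : R -> R, forall t : R, 0 < t -> is_derive t 1 W (w t).
Proof.
move=> cw.
pose F a x := (\int[@lebesgue_measure R]_(t in [set` `[a, x]]) w t)%R.
have dF (a x : R) : 0 < a -> a < x -> is_derive x 1 (F a) (w x).
  move=> a0 ax; have [] := @continuous_FTC1_closed R w a x (x + 1).
  - by rewrite ltrDl.
  - apply: continuous_compact_integrable; first exact: segment_compact.
    apply: continuous_in_subspaceT => t; rewrite inE/= in_itv/= => /andP[at_ _].
    exact/cw/(lt_le_trans a0).
  - exact: ax.
  - exact/cw/(lt_trans a0).
  by rewrite derive1E => dFx <-; exact: DeriveDef.
have Fdiff (a b x : R) : 0 < a -> 0 < b -> a < x -> a < 1 -> b < x -> b < 1 ->
    F a x - F a 1 = F b x - F b 1.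
  move=> a0 b0 ax a1 bx b1.
  have : (F a - F b) x = (F a - F b) 1.
    apply: (@is_derive0_eq _ _ (Num.max a b)); rewrite ?gt_max ?ax ?bx ?a1 ?b1//.
    move=> t; rewrite gt_max => /andP[at_ bt].
    rewrite -[X in is_derive _ _ _ X](subrr (w t)).
    exact: is_deriveB (dF _ _ a0 at_) (dF _ _ b0 bt).
  rewrite !fctE; lra.
(* The base point [Num.min x 1 / 2] lies below both [x] and 1 but moves with [x]; the fixed base
   point [a] chosen next serves for all [s] close to [t]. *)
exists (fun x => F (Num.min x 1 / 2) x - F (Num.min x 1 / 2) 1) => t t0.
pose a := Num.min t 1 / 4.
have at_ : a < t by rewrite /a minEle; case: ifP => ?; lra.
have a1 : a < 1 by rewrite /a minEle; case: ifP => ?; lra.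
have a0 : 0 < a by rewrite /a minEle; case: ifP => ?; lra.
apply: (@near_eq_is_derive _ _ (F a - cst (F a 1))); last first.
  rewrite -[X in is_derive _ _ _ X]subr0; apply: is_deriveB; exact: dF.
near=> s; rewrite !fctE.
have as_ : a < s by near: s; exact: lt_nbhsr.
by apply: Fdiff => //; rewrite minEle; case: ifP => ?; lra.
Unshelve. all: by end_near. Qed.

(** * Monotonicity from the derivative, and the running infimum *)

Lemma is_derive_nondec (R : realType) (f df : R -> R) (a b : R) : a <= b ->
  {within `[a, b], continuous f} ->
  (forall t : R, a < t -> t < b -> is_derive t 1 f (df t)) ->
  (forall t : R, a <= t -> t <= b -> 0 <= df t) -> f a <= f b.
Proof.
move=> ab cf dfP df0; have [t||c] := @MVT_segment R f df a b ab => //.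
  by rewrite in_itv/= => /andP[at_ tb]; exact: dfP.
rewrite in_itv/= => /andP[ac cb] e; rewrite -subr_ge0 e mulr_ge0 ?subr_ge0//.
exact: df0.
Qed.

Lemma is_derive_within_continuous (R : realType) (f df : R -> R) (a b : R) :
  (forall t : R, a <= t -> t <= b -> is_derive t 1 f (df t)) ->
  {within `[a, b], continuous f}.
Proof.
move=> dfP; apply: derivable_within_continuous => t.
by rewrite in_itv/= => /andP[at_ tb]; have [] := dfP t at_ tb.
Qed.

(** As a function of [r > 0], and for [g] bounded below on the positive reals, this is the greatest
    nonincreasing minorant of [g] there. *)
Definition running_inf {R : realType} (g : R -> R) (r : R) : R :=
  inf [set g s | s in [set s | 0 < s <= r]].

Section running_inf.
Variables (R : realType) (g : R -> R) (c : R).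
Hypothesis cg : forall s : R, 0 < s -> c <= g s.

Lemma running_inf_le (r s : R) : 0 < s <= r -> running_inf g r <= g s.
Proof.
move=> sr; apply: ge_inf; last by exists s.
by exists c => _ [u /= /andP[u0 _] <-]; exact: cg.
Qed.

Lemma le_running_inf (r k : R) : 0 < r ->
  (forall s, 0 < s <= r -> k <= g s) -> k <= running_inf g r.
Proof.
move=> r0 kg; apply: lb_le_inf; first by exists (g r), r => //=; rewrite r0 lexx.
by move=> _ [u /= ur <-]; exact: kg.
Qed.

Lemma running_inf_noninc (a b : R) :
  0 < a -> a <= b -> running_inf g b <= running_inf g a.
Proof.
move=> a0 ab; apply: le_running_inf => // s /andP[s0 sa].
by apply: running_inf_le; rewrite s0 (le_trans sa).
Qed.

(** From [a] to [b] the infimum can drop only through values of [g] between these points. When both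
    are close to [t], such values are close to [g a], which is itself at least the infimum up to
    [a]. *)
Lemma running_inf_continuous (t : R) :
  (forall s : R, 0 < s -> {for s, continuous g}) ->
  0 < t -> {for t, continuous (running_inf g)}.
Proof.
move=> gc t0; apply/cvgrPdist_le => e e0.
have e20 : 0 < e / 2 by rewrite divr_gt0.
have /cvgrPdist_le/(_ _ e20)[d /= d0 dP] := gc t t0.
have key (a b : R) : 0 < a -> a <= b -> `|t - a| < d -> `|t - b| < d ->
    `|running_inf g a - running_inf g b| <= e.
  move=> a0 ab da db; have b0 := lt_le_trans a0 ab.
  rewrite ger0_norm ?subr_ge0 ?running_inf_noninc// lerBlDr -lerBlDl.
  apply: le_running_inf => // u /andP[u0 ub]; have [ua|au] := leP u a.
    by have := @running_inf_le a u; rewrite u0 ua => /(_ isT); lra.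
  have := dP a da; have : `|t - u| < d.
    by move: da db; rewrite !ltr_norml => /andP[? ?] /andP[? ?]; apply/andP; lra.
  move=> /dP /=; rewrite !ler_norml => /andP[? ?] /andP[? ?].
  have := @running_inf_le a a; rewrite a0 lexx => /(_ isT); lra.
near=> s.
have s0 : 0 < s by near: s; exact: lt_nbhsr.
have ds : `|t - s| < d by near: s; exists d.
have [ts|st] := leP t s; first by apply: key => //; rewrite subrr normr0.
by rewrite distrC; apply: key => //; rewrite ?ltW// subrr normr0.
Unshelve. all: by end_near. Qed.

End running_inf.

(** * Concave members of the class K, built from a nonincreasing derivative *)

Lemma classK_concave_antiderivative (R : realType) (w W : R -> R) (m : R) :
  (forall t : R, 0 < t -> {for t, continuous w}) ->
  (forall t : R, 0 < t -> 0 < w t) ->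
  (forall a b : R, 0 < a -> a <= b -> w b <= w a) ->
  (forall t : R, 0 < t -> is_derive t 1 W (w t)) ->
  (forall t : R, 0 < t -> m <= W t) ->
  exists psi : R -> R, [/\ classK +oo%E psi, concave_on_nonneg psi &
    forall t : R, 0 < t -> derive1 psi t = w t].
Proof.
move=> wc w0 wdec dW mW.
(* Since [W] is nondecreasing and bounded below, [inf E] is its finite limit at 0; subtracting it
   makes the extension by 0 continuous at 0. *)
pose E := [set W t | t in [set t | 0 < t]].
have lbE : has_lbound E by exists m => _ [t /= t0 <-]; exact: mW.
have E0 : E !=set0 by exists (W 1), 1 => //=.
pose psi t := if 0 < t then W t - inf E else 0.
have dpsi (t : R) : 0 < t -> is_derive t 1 psi (w t).
  move=> t0; apply: (@near_eq_is_derive _ _ (W - cst (inf E))); last first.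
    by rewrite -[X in is_derive _ _ _ X]subr0; apply: is_deriveB; exact: dW.
  by near=> s; rewrite /psi ifT //; near: s; exact: lt_nbhsr.
have d1psi (t : R) : 0 < t -> derive1 psi t = w t.
  by move=> t0; rewrite derive1E; have [] := dpsi t t0.
have Winc (a b : R) : 0 < a -> a <= b -> W a <= W b.
  move=> a0 ab; apply: (@is_derive_nondec _ _ w) => //.
  - apply: (@is_derive_within_continuous _ _ w) => t at_ _.
    exact/dW/(lt_le_trans a0).
  - by move=> t at_ _; exact/dW/(lt_trans a0).
  - by move=> t at_ _; exact/ltW/w0/(lt_le_trans a0).
have psi0 : psi 0 = 0 by rewrite /psi ltxx.
have cpsi : {within [set t : R | 0 <= t /\ (t%:E < +oo)%E], continuous psi}.
  apply/subspace_continuousP => t [t0 _].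
  have [{}t0|] := ltP 0 t.
    by apply: cvg_within_filter; exact: is_derive_continuous (dpsi t t0).
  move=> t0'; have -> : t = 0 :> R by apply/eqP; rewrite eq_le t0 t0'.
  apply/cvgrPdist_le => e e0.
  have [_ [s /= s0 <-] sE] := inf_adherent e0 (conj E0 lbE).
  exists s => //= u /=; rewrite sub0r normrN => us [u0 _].
  rewrite /from_subspace psi0.
  rewrite sub0r normrN /psi; case: ifPn => [up|_]; last by rewrite normr0 ltW.
  have infu : inf E <= W u by apply: ge_inf => //; exists u.
  rewrite ger0_norm ?subr_ge0// lerBlDl (le_trans _ (ltW sE))//.
  by apply: Winc => //; rewrite ltW// -(ger0_norm u0).
exists psi; split=> //.
- split=> // t t0 _; split.
  + by have [] := dpsi t t0.
  + have : derive1 psi x @[x --> t] --> w t.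
      apply: cvg_trans (wc t t0); apply: near_eq_cvg; near=> s.
      by rewrite d1psi//; near: s; exact: lt_nbhsr.
    by rewrite -(d1psi t t0).
  + by rewrite d1psi//; exact: w0.
(* The mean value theorem, with [a = b] allowed. Positivity of the intermediate point matters
   because [w] is controlled only on positive arguments. *)
have slope (a b : R) : 0 <= a -> a <= b ->
    exists2 x, a <= x <= b /\ (a < b -> 0 < x) &
    psi b - psi a = w x * (b - a).
  move=> a0; rewrite le_eqVlt => /orP[/eqP<-|ab].
    by exists a; [rewrite lexx ltxx|rewrite !subrr mulr0].
  have [||x] := @MVT R psi w a b ab.
  - by move=> t; rewrite in_itv/= => /andP[at_ _]; exact/dpsi/(le_lt_trans a0).
  - apply: continuous_subspaceW cpsi => t /=; rewrite in_itv/= => /andP[at_ _].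
    by split; [exact: le_trans at_|rewrite ltry].
  rewrite in_itv/= => /andP[ax xb] eqx; exists x => //.
  by split; [rewrite !ltW|move=> _; exact: le_lt_trans ax].
(* The concavity inequality is unchanged when [s], [t] are swapped and [l] becomes [1 - l]. *)
move=> s t l; wlog st : s t l / s <= t.
  move=> H s0 t0 /andP[l0 l1]; have [st|ts] := leP s t.
    by apply: H => //; rewrite l0.
  have := H t s (1 - l) (ltW ts) t0 s0; rewrite subr_ge0 l1 gerBl l0 => /(_ isT).
  by rewrite (_ : 1 - (1 - l) = l) 1?addrC ?[_ * t + _]addrC//; ring.
move=> s0 t0 /andP[l0 l1]; set z := l * s + _.
have sz : s <= z by rewrite /z; nra.
have zt : z <= t by rewrite /z; nra.
have [x [/andP[sx xz] xp] e1] := slope s z s0 sz.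
have [y [/andP[zy yt] yp] e2] := slope z t (le_trans s0 sz) zt.
have [zs|zs] := eqVneq z s.
  have : l * psi s + (1 - l) * psi t = psi z.
    have : (1 - l) * (t - s) = 0 by move: zs; rewrite /z => zs; nra.
    move=> /eqP; rewrite mulf_eq0 !subr_eq0 => /orP[/eqP<-|/eqP ts].
      by rewrite subrr mul1r mul0r addr0 -zs.
    by rewrite zs ts -mulrDl addrC subrK mul1r.
  by move=> ->.
have sz' : s < z by rewrite lt_neqAle eq_sym zs.
have wyx : w y <= w x by apply: wdec; [exact: xp|exact: le_trans zy].
(* With [z - s = (1 - l) * (t - s)] and [t - z = l * (t - s)], both weighted increments share the
   factor [l * (1 - l) * (t - s)], so concavity reduces to [w y <= w x]. *)
have e1' : l * (psi z - psi s) = w x * (l * (1 - l) * (t - s)).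
  by rewrite e1 /z; ring.
have e2' : (1 - l) * (psi t - psi z) = w y * (l * (1 - l) * (t - s)).
  by rewrite e2 /z; ring.
have : w y * (l * (1 - l) * (t - s)) <= w x * (l * (1 - l) * (t - s)).
  by rewrite ler_wpM2r// !mulr_ge0// subr_ge0.
by rewrite -e1' -e2'; lra.
Unshelve. all: by end_near. Qed.

Lemma classK_is_derive (R : realType) (rbar : \bar R) (phi : R -> R) (t : R) :
  classK rbar phi -> 0 < t -> (t%:E < rbar)%E -> is_derive t 1 phi (derive1 phi t).
Proof.
move=> [_ _ dphi] t0 tr; have [dt _ _] := dphi t t0 tr.
by rewrite derive1E; exact: DeriveDef.
Qed.

Lemma classK_lt (R : realType) (rbar : \bar R) (phi : R -> R) (a b : R) :
  classK rbar phi -> 0 <= a -> a < b -> (b%:E < rbar)%E -> phi a < phi b.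
Proof.
move=> K a0 ab br; have [cphi _ dphi] := K.
have in_dom (t : R) : t <= b -> (t%:E < rbar)%E.
  by move=> tb; apply: le_lt_trans br; rewrite lee_fin.
have [t||c] := @MVT R phi (derive1 phi) a b ab.
- rewrite in_itv/= => /andP[at_ tb].
  by apply: (classK_is_derive _ _ _ _ K); [exact: le_lt_trans at_|exact/in_dom/ltW].
- apply: continuous_subspaceW cphi => t /=; rewrite in_itv/= => /andP[at_ tb].
  by split; [exact: le_trans at_|exact: in_dom].
rewrite in_itv/= => /andP[ac cb] e; rewrite -subr_gt0 e mulr_gt0 ?subr_gt0//.
by have [] := dphi c (le_lt_trans a0 ac) (in_dom _ (ltW cb)).
Qed.

Lemma classK_le (R : realType) (rbar : \bar R) (phi : R -> R) (a b : R) :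
  classK rbar phi -> 0 <= a -> a <= b -> (b%:E < rbar)%E -> phi a <= phi b.
Proof.
move=> K a0; rewrite le_eqVlt => /orP[/eqP-> //|ab] br.
exact/ltW/(classK_lt _ _ _ _ _ K).
Qed.

(** The last conclusion transfers to [psi] at [t] every lower bound [k] of the derivative of [phi]
    over levels up to both [t] and [r1]; it is applied with [k] the inverse norm of a subgradient.
    The constant [c] keeps the running infimum positive. *)
Lemma classK_concave_desingularization (R : realType) (phi : R -> R)
    (r0 r1 c : R) :
  classK r0%:E phi -> 0 < r1 -> r1 < r0 -> 0 < c ->
  (forall s : R, 0 < s -> s <= r1 -> c <= derive1 phi s) ->
  exists psi : R -> R, [/\ classK +oo%E psi, concave_on_nonneg psi &
    forall t k : R, 0 < t ->
      (forall s : R, 0 < s -> s <= t -> s <= r1 -> k <= derive1 phi s) ->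
      k <= derive1 psi t].
Proof.
move=> K r10 r1r0 c0 cphi; have [_ phi0 dphi] := K.
(* Freezing the derivative at [r1 < r0] extends it to all positive levels while preserving
   continuity. *)
pose g s := derive1 phi (Num.min s r1).
have min0 (s : R) : 0 < s -> 0 < Num.min s r1 by rewrite lt_min r10 => ->.
have min1 (s : R) : Num.min s r1 <= r1 by rewrite ge_min lexx orbT.
have cg (s : R) : 0 < s -> c <= g s by move=> s0; exact: cphi (min0 s s0) (min1 s).
have gc (s : R) : 0 < s -> {for s, continuous g}.
  move=> s0; apply: (@continuous_comp _ _ _ (fun s : R => Num.min s r1)).
    by apply: continuous_min; [exact: cvg_id|exact: cvg_cst].
  have [] // := dphi (Num.min s r1) (min0 s s0).
  by rewrite lte_fin (le_lt_trans (min1 s)).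
pose w := running_inf g.
have wc (t : R) : 0 < t -> {for t, continuous w}.
  by move=> t0; exact: (running_inf_continuous _ g c).
have w0 (t : R) : 0 < t -> 0 < w t.
  move=> t0; apply: (lt_le_trans c0); apply: le_running_inf => // s /andP[s0 _].
  exact: cg.
have wdec (a b : R) : 0 < a -> a <= b -> w b <= w a.
  exact: (running_inf_noninc _ g c).
have [W dW] := antiderivative_pos _ w wc.
have phi_ge0 (t : R) : 0 <= t -> t <= r1 -> 0 <= phi t.
  move=> t0 tr1; rewrite -phi0; apply: (classK_le _ _ _ _ _ K) => //.
  by rewrite lte_fin (le_lt_trans tr1).
have dphi' (t : R) : 0 < t -> t <= r1 -> is_derive t 1 phi (derive1 phi t).
  move=> t0 tr1; apply: (classK_is_derive _ _ _ _ K) => //.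
  by rewrite lte_fin (le_lt_trans tr1).
(* The bound [W r1 - phi r1] expresses integrability of [w] at 0: up to [r1], [phi - W] is
   nondecreasing because [w] is at most the derivative of [phi], and [phi >= 0]; beyond [r1], [W]
   exceeds [W r1], and [phi r1 >= 0]. *)
have [|psi [Kp cp dp]] :=
    classK_concave_antiderivative _ w W (W r1 - phi r1) wc w0 wdec dW.
  move=> t t0; have [tr1|r1t] := leP t r1; last first.
    have : W r1 <= W t.
      apply: (@is_derive_nondec _ _ w); first exact: ltW.
      - apply: (@is_derive_within_continuous _ _ w) => s rs _.
        exact/dW/(lt_le_trans r10).
      - by move=> s rs _; exact/dW/(lt_trans r10).
      - by move=> s rs _; exact/ltW/w0/(lt_le_trans r10).
    by have := phi_ge0 _ (ltW r10) (lexx _); lra.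
  have dD (s : R) : t <= s -> s <= r1 ->
      is_derive s 1 (phi - W) (derive1 phi s - w s).
    move=> ts sr1; have s0 := lt_le_trans t0 ts.
    by apply: is_deriveB; [exact: dphi'|exact: dW].
  have : (phi - W) t <= (phi - W) r1.
    apply: (@is_derive_nondec _ _ (fun s => derive1 phi s - w s)) => //.
    - by apply: is_derive_within_continuous; exact: dD.
    - by move=> s ts sr; apply: dD; exact: ltW.
    - move=> s ts sr; rewrite subr_ge0.
      have := running_inf_le _ g c cg s s; rewrite (lt_le_trans t0 ts) lexx.
      by move=> /(_ isT)/le_trans; apply; rewrite /g min_l.
  by rewrite !fctE; have := phi_ge0 t (ltW t0) tr1; lra.
exists psi; split=> // t k t0 kphi; rewrite dp//.
apply: le_running_inf => // s /andP[s0 st]; apply: kphi => //; first exact: min0.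
by rewrite ge_min st.
Qed.

Lemma small_scale (R : realType) (rho a b : R) : 0 < rho -> 0 <= a -> 0 <= b ->
  exists t : R, [/\ 0 < t, t <= 1, t * a < rho & t * b < rho].
Proof.
move=> rho0 a0 b0; exists (rho / (a + b + 1 + rho)).
have d0 : 0 < a + b + 1 + rho by lra.
split; first by rewrite divr_gt0.
- by rewrite ler_pdivrMr//; lra.
- by rewrite mulrAC ltr_pdivrMr//; nra.
- by rewrite mulrAC ltr_pdivrMr//; nra.
Qed.

(** * Hilbert space geometry: Cauchy-Schwarz and projection onto a closed convex set *)

Section inner_product.
Context {R : realType} {V : completeNormedModType R}.
Variable inner : V -> V -> R.
Hypothesis ip : is_inner_product inner.

Lemma innerC x y : inner x y = inner y x.
Proof. by have [h _ _ _] := ip. Qed.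

Lemma innerDl x y z : inner (x + y) z = inner x z + inner y z.
Proof. by have [_ h _ _] := ip; have := h 1 x y z; rewrite scale1r mul1r. Qed.

Lemma inner0l z : inner 0 z = 0.
Proof. by have := innerDl 0 0 z; rewrite addr0; lra. Qed.

Lemma innerZl a x z : inner (a *: x) z = a * inner x z.
Proof.
by have [_ h _ _] := ip; have := h a x 0 z; rewrite !addr0 inner0l addr0.
Qed.

Lemma innerNl x z : inner (- x) z = - inner x z.
Proof. by rewrite -scaleN1r innerZl mulN1r. Qed.

Lemma innerBl x y z : inner (x - y) z = inner x z - inner y z.
Proof. by rewrite innerDl innerNl. Qed.

Lemma innerZr a x z : inner z (a *: x) = a * inner z x.
Proof. by rewrite innerC innerZl innerC. Qed.

Lemma innerNr x z : inner z (- x) = - inner z x.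
Proof. by rewrite innerC innerNl innerC. Qed.

Lemma innerDr x y z : inner z (x + y) = inner z x + inner z y.
Proof. by rewrite innerC innerDl !(innerC z). Qed.

Lemma innerBr x y z : inner z (x - y) = inner z x - inner z y.
Proof. by rewrite innerC innerBl !(innerC z). Qed.

Lemma inner_norm (x : V) : inner x x = `|x| ^+ 2.
Proof. by have [_ _ h n] := ip; rewrite n sqr_sqrtr. Qed.

Lemma inner_le_norm (x y : V) : inner x y <= `|x| * `|y|.
Proof.
have [->|x0] := eqVneq x 0; first by rewrite inner0l normr0 mul0r.
have [->|y0] := eqVneq y 0; first by rewrite innerC inner0l normr0 mulr0.
have nx : 0 < `|x| by rewrite normr_gt0.
have ny : 0 < `|y| by rewrite normr_gt0.
have : 0 <= inner (`|y| *: x - `|x| *: y) (`|y| *: x - `|x| *: y).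
  by rewrite inner_norm sqr_ge0.
rewrite !(innerBl, innerBr, innerZl, innerZr) !inner_norm (innerC y x) => h.
have : 0 <= (`|x| * `|y|) * (2 * (`|x| * `|y| - inner x y)) by nra.
by rewrite pmulr_rge0 ?mulr_gt0// pmulr_rge0// subr_ge0.
Qed.

Lemma parallelogram (x y : V) :
  `|x - y| ^+ 2 + `|x + y| ^+ 2 = 2 * `|x| ^+ 2 + 2 * `|y| ^+ 2.
Proof.
rewrite -!inner_norm !(innerDl, innerDr, innerNl, innerNr) (innerC y x); ring.
Qed.

Definition convex_subset (C : set V) := forall x y (t : R), 0 <= t <= 1 ->
  C x -> C y -> C (t *: x + (1 - t) *: y).

(** The sets [A e] of near-minimizers of the squared distance generate a filter. The parallelogram
    law, applied with midpoints in [C], makes it Cauchy; completeness gives a limit, which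
    closedness keeps in [C]. *)
Lemma nearest_point (C : set V) (x : V) : closed C -> convex_subset C -> C !=set0 ->
  exists2 y : V, C y & forall z : V, C z -> `|x - y| <= `|x - z|.
Proof.
move=> Ccl Ccv [z0 Cz0].
pose E := [set `|x - z| ^+ 2 | z in C].
have lbE : has_lbound E by exists 0 => _ [z _ <-]; exact: sqr_ge0.
have E0 : E !=set0 by exists (`|x - z0| ^+ 2), z0.
have leE (z : V) : C z -> inf E <= `|x - z| ^+ 2.
  by move=> Cz; apply: ge_inf => //; exists z.
pose A (e : R) := [set z | C z /\ `|x - z| ^+ 2 < inf E + e].
have A0 (e : R) : 0 < e -> A e !=set0.
  by move=> e0; have [_ [z Cz <-] ?] := inf_adherent e0 (conj E0 lbE); exists z.
pose F := filter_from [set e : R | 0 < e] A.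
have FF : ProperFilter F.
  apply: filter_from_proper; last by move=> e /= e0; exact: A0.
  apply: filter_from_filter; first by exists 1 => //=.
  move=> a b /= a0 b0; exists (Num.min a b); first by rewrite /= lt_min a0.
  move=> z [Cz]; rewrite -ltrBlDl lt_min !ltrBlDl => /andP[? ?].
  by split; split.
have cF : cvg F.
  apply/cauchy_cvgP/cauchy_exP => e e0.
  (* For two points of [A (e ^+ 2 / 8)], the midpoint has squared distance at least [inf E] to [x],
     so the parallelogram law bounds their squared distance by [e ^+ 2 / 2]. *)
  have e80 : 0 < e ^+ 2 / 8 by rewrite divr_gt0 ?exprn_gt0.
  have [z [Cz zE]] := A0 _ e80.
  exists z; exists (e ^+ 2 / 8) => // z' [Cz' zE'].
  rewrite -ball_normE /=.
  have := parallelogram (x - z') (x - z).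
  rewrite (_ : x - z' - (x - z) = z - z'); last first.
    by rewrite opprB addrC addrA subrK.
  move=> par.
  have Cm : C (2^-1 *: z' + (1 - 2^-1) *: z).
    by apply: Ccv => //; apply/andP; split; lra.
  have := leE _ Cm.
  have -> : x - (2^-1 *: z' + (1 - 2^-1) *: z) = 2^-1 *: ((x - z') + (x - z)).
    rewrite (_ : 1 - 2^-1 = 2^-1 :> R); last by field.
    have xx : x = 2^-1 *: (x + x).
      by rewrite scalerDr -scalerDl (_ : 2^-1 + 2^-1 = 1 :> R) ?scale1r//; field.
    by rewrite [in LHS]xx -scalerDr -scalerBr opprD addrACA.
  rewrite normrZ exprMn ger0_norm ?invr_ge0// => mE.
  have nz : `|z - z'| ^+ 2 < e ^+ 2 by nra.
  by move: nz; rewrite ltr_pXn2r// nnegrE// ltW.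
exists (lim F).
  apply: contrapT => nC.
  have /cF : nbhs (lim F) (~` C).
    by apply: open_nbhs_nbhs; split => //; exact: closed_openC.
  move=> [e /= e0 sAC]; have [z Az] := A0 e e0; exact: sAC z Az (proj1 Az).
move=> z Cz; rewrite leNgt; apply/negP => zy.
(* If [z] were strictly closer than the limit, points near the limit would be farther than [h] from
   [x], whereas sufficiently good minimizers are closer than [h]. *)
pose h := (`|x - z| + `|x - lim F|) / 2.
have zh : `|x - z| < h by rewrite /h; lra.
have hy : h < `|x - lim F| by rewrite /h; lra.
have h0 : 0 <= h by apply: ltW; exact: le_lt_trans zh.
have : nbhs (lim F) [set u | h < `|x - u|].
  apply/nbhs_ballP; exists (`|x - lim F| - h); first by rewrite /= subr_gt0.
  move=> u; rewrite -ball_normE /= => yu.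
  have := ler_distD u x (lim F); rewrite (distrC u); lra.
move=> /cF [e /= e0 Ae].
have eh : 0 < Num.min e (h ^+ 2 - inf E).
  rewrite lt_min e0 subr_gt0 (le_lt_trans (leE _ Cz))//.
  by rewrite ltr_pXn2r// nnegrE.
have [u [Cu]] := A0 _ eh; rewrite -ltrBlDl lt_min !ltrBlDl => /andP[ue uh].
have /= hu := Ae u (conj Cu ue).
have {uh} : `|x - u| ^+ 2 < h ^+ 2 by move: uh; lra.
rewrite ltr_pXn2r// ?nnegrE// => /(lt_trans hu).
by rewrite ltxx.
Qed.

(** If the inner product were positive, moving from [y] a small fraction [t] of the way to [z] would
    lower the squared distance to [x]: the gain is linear in [t], the loss quadratic. *)
Lemma projection (C : set V) (x : V) : closed C -> convex_subset C -> C !=set0 ->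
  exists2 y : V, C y & forall z : V, C z -> inner (x - y) (z - y) <= 0.
Proof.
move=> Ccl Ccv C0; have [y Cy ymin] := nearest_point C x Ccl Ccv C0.
exists y => // z Cz; rewrite leNgt; apply/negP => l0.
have [t [t0 t1 tz _]] := small_scale _ _ _ 0 l0 (sqr_ge0 `|z - y|) (lexx 0).
have := ymin _ (Ccv z y t _ Cz Cy); rewrite (ltW t0) t1 => /(_ isT).
have -> : x - (t *: z + (1 - t) *: y) = (x - y) - t *: (z - y).
  rewrite scalerBl scale1r scalerBr !opprD !opprK -!addrA.
  by congr (_ + _); rewrite addrCA.
rewrite -(@ler_pXn2r _ 2)// ?nnegrE// -!inner_norm.
rewrite !(innerBl (x - y), innerBr (x - y), innerBr _ (t *: _), innerZl, innerZr).
rewrite (innerC (z - y)) (inner_norm (z - y)).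
have := mulr_gt0 t0 l0; nra.
Qed.

End inner_product.

(** * Fréchet subgradients of the composition versus convex subgradients of [f] *)

Lemma limf_einf_ge0P (R : realType) (T : pseudoPMetricType R) (h : T -> \bar R)
    (F : set_system T) : Filter F ->
  (0 <= limf_einf h F)%E <->
  forall e : R, 0 < e -> F [set y | ((- e)%:E <= h y)%E].
Proof.
move=> FF; rewrite limf_einfE; split=> [h0 e e0|h0].
  have : ((- e)%:E < ereal_sup [set ereal_inf (h @` A) | A in F])%E.
    by apply: lt_le_trans h0; rewrite lte_fin oppr_lt0.
  move=> /ereal_sup_gt[_ [A FA <-] eA]; apply: filterS FA => y Ay /=.
  by apply: (le_trans (ltW eA)); apply: ereal_inf_lbound; exists y.
apply/lee_addgt0Pr => e e0; rewrite -leeBlDr// sub0e -EFinN.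
apply: ereal_sup_ge; exists (ereal_inf (h @` [set y | ((- e)%:E <= h y)%E])).
  by exists [set y | ((- e)%:E <= h y)%E] => //; exact: h0.
by apply/ereal_infP => _ [y /= hy <-].
Qed.

Section subgradients.
Context {R : realType} {V : completeNormedModType R}.
Variables (inner : V -> V -> R) (f : V -> \bar R).
Hypothesis ip : is_inner_product inner.

(** Multiplying by the positive [|y - x|] removes the quotient. Where [g y] is [+oo] both
    inequalities hold, and where it is [-oo] both fail. *)
Lemma frechet_subdiffP (g : V -> \bar R) (x p : V) :
  frechet_subdiff inner g x p <->
  g x \is a fin_num /\ forall e : R, 0 < e -> \forall y \near x, y != x ->
    ((fine (g x) + inner p (y - x) - e * `|y - x|)%:E <= g y)%E.
Proof.
rewrite /frechet_subdiff /=; split=> -[gx]; move: (gx) => /fineK <- /=; last first.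
  move=> H; split=> //; apply/limf_einf_ge0P => e e0.
  apply: filterS (H e e0) => y H' yx; move: (H' yx).
  have n0 : 0 < `|y - x| by rewrite normr_gt0 subr_eq0.
  rewrite /=; case: (g y) => [r| |] //=.
    by rewrite !lee_fin ler_pdivlMr// mulNr; lra.
  by move=> _; rewrite gt0_mulye ?lte_fin ?invr_gt0// leey.
move=> /limf_einf_ge0P H; split=> // e e0.
have := H e e0; rewrite /dnbhs /within /= => He.
apply: filterS He => y H' yx; move: (H' yx).
have n0 : 0 < `|y - x| by rewrite normr_gt0 subr_eq0.
rewrite /=; case: (g y) => [r| |] //=.
- by rewrite !lee_fin ler_pdivlMr// mulNr; lra.
- by rewrite leey.
- by rewrite gt0_mulNye ?lte_fin ?invr_gt0.
Qed.

(** The global subgradient of convex analysis. As [fine] sends infinite values to 0, it is used only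
    where [f x] is finite. *)
Definition subgradient (x p : V) :=
  forall z : V, ((fine (f x) + inner p (z - x))%:E <= f z)%E.

Lemma compK_fin_num (rbar : \bar R) (phi : R -> R) (x : V) :
  compK rbar phi f x \is a fin_num -> (0 <= f x)%E /\ (f x < rbar)%E.
Proof. by rewrite /compK; case: ifP => // /andP[]. Qed.

Hypothesis f_ge0 : forall x, (0 <= f x)%E.

Lemma fin_num_efun (x : V) : (f x < +oo)%E -> f x \is a fin_num.
Proof. by move=> fx; rewrite ge0_fin_numE. Qed.

(* [f] may be discontinuous at [x]: monotonicity of [phi] lets the affine
   minorant of [f] at [x] replace [f] in the difference quotient. *)
Lemma frechet_subdiff_compK (rbar : \bar R) (phi : R -> R) (x q : V) :
  classK rbar phi -> (0 < f x)%E -> (f x < rbar)%E -> subgradient x q ->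
  frechet_subdiff inner (compK rbar phi f) x (derive1 phi (fine (f x)) *: q).
Proof.
move=> K fx0 fxr qs.
have fxfin : f x \is a fin_num by apply/fin_num_efun/(lt_le_trans fxr)/leey.
move: fx0 fxr qs; rewrite /subgradient -(fineK fxfin) /=.
set a := fine (f x) => a0 ar qs; rewrite lte_fin in a0.
have compKx : compK rbar phi f x = (phi a)%:E.
  by rewrite /compK -(fineK fxfin) lee_fin (ltW a0) ar.
apply/frechet_subdiffP; rewrite compKx; split=> //= e e0.
set d := derive1 phi a.
have q1 : 0 < `|q| + 1 by rewrite ltr_wpDl.
have e'0 : 0 < e / (`|q| + 1) by rewrite divr_gt0.
have /is_derive_expansion/(_ _ e'0)[rho /= rho0 rhoP] :=
  classK_is_derive _ _ _ _ K a0 ar.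
(* Here [rho] is the range of validity of the expansion of [phi], and [a] keeps the level
   [a + inner q (y - x)] nonnegative, where [phi] is monotone. *)
pose dl := Num.min rho a.
have dl0 : 0 < dl by rewrite lt_min rho0.
apply/nbhs_ballP; exists (dl / (`|q| + 1)); first by rewrite /= divr_gt0.
move=> y; rewrite -ball_normE /= distrC ltr_pdivlMr// => yx _.
have qy : `|inner q (y - x)| <= `|q| * `|y - x|.
  rewrite ler_norml inner_le_norm// andbT lerNl -(innerNr _ ip).
  by rewrite -(normrN (y - x)); exact: inner_le_norm _ ip _ _.
have qdl : `|inner q (y - x)| < dl.
  by apply: le_lt_trans yx; apply: (le_trans qy); rewrite mulrDr mulr1 mulrC lerDl.
rewrite {1}/compK f_ge0 /=; case: ifPn => [fyr|_]; last by rewrite leey.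
have fyfin : f y \is a fin_num by apply/fin_num_efun/(lt_le_trans fyr)/leey.
have := qs y; move: fyr; rewrite -(fineK fyfin) /= !lee_fin.
set b := fine _ => br sb.
move: qdl; rewrite lt_min => /andP[qrho qa].
have s0 : 0 <= a + inner q (y - x) by move: qa; rewrite ltr_norml => /andP[]; lra.
apply: le_trans (classK_le _ _ _ _ _ K s0 sb br).
have := rhoP (a + inner q (y - x)); rewrite /= opprD addNKr normrN => /(_ qrho).
rewrite -/d (_ : a + inner q (y - x) - a = inner q (y - x)); last by ring.
move=> H.
have H2 : e / (`|q| + 1) * `|inner q (y - x)| <= e * `|y - x|.
  rewrite mulrAC ler_pdivrMr// -mulrA ler_pM2l//.
  by apply: (le_trans qy); rewrite mulrDr mulr1 mulrC lerDl.
rewrite innerZl//; move: H; rewrite ler_norml => /andP[]; lra.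
Qed.

Hypothesis f_cvx : convex_efun f.

(** Convexity makes the local condition global: on the segment from [x] to [z], [f] is at most
    [a + t * (b - a)], so expanding [phi] at [a] and dividing by [t] gives
    [inner p (z - x) <= d * (b - a)] up to a small error. Then divide by [d > 0]. *)
Lemma subgradient_frechet_compK (rbar : \bar R) (phi : R -> R) (x p : V) :
  classK rbar phi -> (0 < f x)%E -> frechet_subdiff inner (compK rbar phi f) x p ->
  [/\ f x \is a fin_num, (f x < rbar)%E &
     subgradient x ((derive1 phi (fine (f x)))^-1 *: p)].
Proof.
move=> K fx0 /frechet_subdiffP[cfin H].
have [_ fxr] := compK_fin_num _ _ _ cfin.
have fxfin : f x \is a fin_num by apply/fin_num_efun/(lt_le_trans fxr)/leey.
split=> //; move: fx0 fxr; rewrite /subgradient -(fineK fxfin) /=.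
have /fineK := fxfin; set a := fine (f x) => fxa a0 ar; rewrite lte_fin in a0.
have compKx : compK rbar phi f x = (phi a)%:E.
  by rewrite /compK -fxa lee_fin (ltW a0) ar.
rewrite compKx /= in H.
have [_ _ /(_ _ a0 ar)[_ _ d0]] := K.
have da := classK_is_derive _ _ _ _ K a0 ar.
set d := derive1 phi a in d0 da *.
move=> z; have [fzoo|] := boolP (f z < +oo)%E; last first.
  by rewrite -leNgt leye_eq => /eqP->; rewrite leey.
have fzfin := fin_num_efun _ fzoo.
rewrite -(fineK fzfin) lee_fin; set b := fine (f z).
rewrite innerZl// addrC -lerBrDr mulrC ler_pdivrMr// mulrC.
apply/ler_addgt0Pr => e e0.
pose e1 := e / (`|z - x| + `|b - a| + 1).
have n1 : 0 < `|z - x| + `|b - a| + 1 by rewrite ltr_wpDl// addr_ge0.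
have e10 : 0 < e1 by rewrite divr_gt0.
have [zx|zx] := eqVneq z x.
  by rewrite /b zx subrr innerC// inner0l// subrr mulr0 add0r ltW.
have /nbhs_ballP[rho1 /= rho10 rho1P] := H _ e10.
have /is_derive_expansion/(_ _ e10)/nbhs_ballP[rho2 /= rho20 rho2P] := da.
have : \forall s \near a, (s%:E < rbar)%E.
  case: (rbar) ar => [r| |] //.
    rewrite lte_fin => ar; near=> s; rewrite lte_fin; near: s.
    exact: lt_nbhsl.
  by move=> _; near=> s; rewrite ltry.
move=> /nbhs_ballP[rho3 /= rho30 rho3P].
(* The three radii serve the Fréchet inequality at [x], the expansion of [phi] at [a], and the
   requirement that levels stay below [rbar]. *)
pose rho := Num.min rho1 (Num.min rho2 rho3).
have rho0 : 0 < rho by rewrite !lt_min rho10 rho20.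
have [t [t0 t1]] := small_scale _ _ _ _ rho0 (normr_ge0 (z - x)) (normr_ge0 (b - a)).
rewrite !lt_min => /andP[tz _] /and3P[_ tb2 tb3].
have yx : (t *: z + (1 - t) *: x) - x = t *: (z - x).
  by rewrite scalerBl scale1r scalerBr addrA addrAC addrK.
have := rho1P (t *: z + (1 - t) *: x).
rewrite -ball_normE /= distrC yx normrZ gtr0_norm//.
move=> /(_ tz); rewrite -subr_eq0 yx scaler_eq0 subr_eq0 (negbTE zx) orbF.
rewrite gt_eqF// => /(_ isT) Hy.
have := f_cvx z x t; rewrite (ltW t0) t1 -fxa -(fineK fzfin) !ltry.
move=> /(_ isT isT isT); rewrite -!EFinM -EFinD -/b => fy.
have st : t * b + (1 - t) * a = a + t * (b - a) by ring.
rewrite st in fy.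
have nt : `|a - (a + t * (b - a))| = t * `|b - a|.
  by rewrite opprD addNKr normrN normrM gtr0_norm.
have sr : ((a + t * (b - a))%:E < rbar)%E by apply: rho3P; rewrite /ball/= nt.
have := rho2P (a + t * (b - a)); rewrite /ball/= nt => /(_ tb2).
move=> Hs; set y := t *: z + _ in fy Hy.
have yfin : f y \is a fin_num by apply/fin_num_efun/(le_lt_trans fy)/ltry.
have fyr : (f y < rbar)%E by exact: le_lt_trans fy sr.
rewrite /compK f_ge0 fyr /= lee_fin in Hy.
have Hphi : phi (fine (f y)) <= phi (a + t * (b - a)).
  by apply: (classK_le _ _ _ _ _ K) => //; [exact: fine_ge0|rewrite -lee_fin fineK].
have {Hs} : phi (a + t * (b - a)) <= phi a + d * (t * (b - a)) + e1 * (t * `|b - a|).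
  move: Hs; rewrite (_ : a + t * (b - a) - a = t * (b - a)) ?[`|t * _|]normrM;
    last by ring.
  rewrite (gtr0_norm t0).
  by rewrite ler_norml => /andP[_]; lra.
move: Hy; rewrite innerZr// => Hy Hs.
have : t * inner p (z - x) <= t * (d * (b - a) + e1 * (`|z - x| + `|b - a|)) by lra.
rewrite ler_pM2l// => /le_trans; apply; rewrite lerD2l /e1 mulrAC ler_pdivrMr//.
by rewrite ler_pM2l// lerDl.
Unshelve. all: by end_near. Qed.

End subgradients.

(** * Descending to a lower level without lengthening the subgradient *)

Section level_descent.
Context {R : realType} {V : completeNormedModType R}.
Variables (inner : V -> V -> R) (f : V -> \bar R).
Hypothesis ip : is_inner_product inner.
Hypothesis f_ge0 : forall x, (0 <= f x)%E.
Hypothesis f_cvx : convex_efun f.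
Hypothesis f_lsc : lower_semicontinuous f.

Lemma sublevel_closed (r : R) : closed [set z | (f z <= r%:E)%E].
Proof.
rewrite (_ : [set z | _] = ~` [set z | (r%:E < f z)%E]).
  by apply: open_closedC; exact: (lower_semicontinuousP f).1.
by apply/seteqP; split=> z /=; rewrite leNgt => /negP.
Qed.

Lemma convex_fine (x y : V) (t : R) : 0 <= t <= 1 ->
  (f x < +oo)%E -> (f y < +oo)%E ->
  (f (t *: x + (1 - t) *: y)%R < +oo)%E /\
  fine (f (t *: x + (1 - t) *: y)%R) <= t * fine (f x) + (1 - t) * fine (f y).
Proof.
move=> t01 fx fy; have := f_cvx x y t t01 fx fy.
rewrite -(fineK (fin_num_efun f f_ge0 x fx)) -(fineK (fin_num_efun f f_ge0 y fy)).
rewrite -!EFinM -EFinD => h; have foo := le_lt_trans h (ltry _).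
by split=> //; rewrite -lee_fin (fineK (fin_num_efun f f_ge0 _ foo)).
Qed.

Lemma sublevel_convex (r : R) : convex_subset [set z | (f z <= r%:E)%E].
Proof.
move=> x y t t01 /= fx fy.
have fx' := le_lt_trans fx (ltry r); have fy' := le_lt_trans fy (ltry r).
have [foo h] := convex_fine x y t t01 fx' fy'.
rewrite -(fineK (fin_num_efun f f_ge0 _ foo)) lee_fin; apply: (le_trans h).
move: fx fy t01; rewrite -(fineK (fin_num_efun f f_ge0 x fx')).
rewrite -(fineK (fin_num_efun f f_ge0 y fy')) !lee_fin => fx fy /andP[t0 t1]; nra.
Qed.

(* The projection [y] of [x] onto [f <= r] carries the subgradient
   [lam *: (x - y)], where [lam] is the least slope of [f] seen from level [r]
   in the direction [x - y]; the segment from [y] to [x] bounds [lam]. *)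
Lemma subgradient_descent (x p : V) (r : R) :
  [set z | (f z <= r%:E)%E] !=set0 ->
  f x \is a fin_num -> (r%:E < f x)%E -> subgradient inner f x p ->
  exists y q : V, [/\ f y = r%:E, subgradient inner f y q & `|q| <= `|p|].
Proof.
move=> C0 fxfin rx ps.
have [y /= fyr yproj] :=
  projection inner ip _ x (sublevel_closed r) (sublevel_convex r) C0.
pose F z := fine (f z).
have fE z : (f z < +oo)%E -> f z = (F z)%:E.
  by move=> fz; rewrite /F fineK//; exact: (fin_num_efun f f_ge0).
have foo_x : (f x < +oo)%E by rewrite -(fineK fxfin) ltry.
have foo_y := le_lt_trans fyr (ltry r).
pose d := x - y; pose l z := inner d (z - y).
have l_cvx (u v : V) (t : R) : l (t *: u + (1 - t) *: v) = t * l u + (1 - t) * l v.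
  rewrite /l -(innerZr _ ip) -(innerZr _ ip) -(innerDr _ ip); congr (inner _ _).
  rewrite !scalerBr addrACA -opprD -scalerDl.
  by rewrite (_ : t + (1 - t) = 1) ?scale1r//; ring.
(* By the projection inequality, points strictly on the side of [x] of the hyperplane [l = 0]
   through [y] lie above level [r]. *)
have rF z : (f z < +oo)%E -> 0 < l z -> r < F z.
  move=> fz lz; rewrite ltNge; apply/negP => Fr.
  by have := yproj z; rewrite /= fE// lee_fin Fr => /(_ isT); rewrite leNgt lz.
have d0 : d != 0.
  rewrite subr_eq0; apply/eqP => xy; move: fyr; rewrite -xy leNgt.
  by move=> /negP; apply.
have lx : l x = `|d| ^+ 2 by rewrite /l -/d inner_norm.
have lx0 : 0 < l x by rewrite lx exprn_gt0// normr_gt0.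
have rFx := rF x foo_x lx0.
(* A point below level [r] on the hyperplane [l = 0] could be pushed
   towards [x]. *)
have rF0 z : (f z < +oo)%E -> l z = 0 -> r <= F z.
  move=> fz lz; rewrite leNgt; apply/negP => Fzr.
  have rz : 0 < r - F z by lra.
  have xz : 0 <= F x - F z by lra.
  have [t [t0 t1 tt _]] := small_scale _ _ _ 0 rz xz (lexx 0).
  have t01 : 0 <= t <= 1 by rewrite (ltW t0).
  have [uoo] := convex_fine x z t t01 foo_x fz; rewrite -/(F _) -/(F x) -/(F z).
  have := rF _ uoo; rewrite l_cvx lz mulr0 addr0 mulr_gt0// => /(_ isT); lra.
have ly : l y = 0 by rewrite /l subrr (innerC _ ip) inner0l.
have Fy : F y = r.
  apply/eqP; rewrite eq_le rF0// andbT.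
  by move: fyr; rewrite fE// lee_fin.
pose S := [set (F z - r) / l z | z in [set z | (f z < +oo)%E /\ 0 < l z]].
have S0 : S !=set0 by exists ((F x - r) / l x), x.
have lbS : has_lbound S.
  exists 0 => _ [z /= [fz lz] <-]; rewrite divr_ge0 ?(ltW lz)// subr_ge0.
  by rewrite ltW// rF.
pose lam := inf S.
have lam_le z : (f z < +oo)%E -> 0 < l z -> lam * l z <= F z - r.
  by move=> fz lz; rewrite -ler_pdivlMr//; apply: ge_inf => //; exists z.
have le_lam k : (forall z, (f z < +oo)%E -> 0 < l z -> k * l z <= F z - r) -> k <= lam.
  by move=> H; apply: lb_le_inf => // _ [z /= [fz lz] <-]; rewrite ler_pdivlMr// H.
have lam0 : 0 <= lam.
  by apply: le_lam => z fz lz; rewrite mul0r subr_ge0 ltW// rF.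
exists y, (lam *: d); split; first by rewrite fE// Fy.
  move=> z; rewrite -/(F y) Fy innerZl// -/(l z).
  have [fz|] := boolP (f z < +oo)%E; last first.
  by rewrite -leNgt leye_eq => /eqP->; rewrite leey.
  rewrite fE// lee_fin; have [lz|lz|lz] := ltgtP (l z) 0; last 2 first.
  - by have := lam_le z fz lz; lra.
  - by rewrite lz mulr0 addr0 rF0.
  have [Fr|Fr] := leP r (F z); first by nra.
  (* Behind the hyperplane and below level [r], the slope seen from [z] must not exceed any slope
     seen from a point [u] in front. *)
  suff : (r - F z) / (- l z) <= lam by rewrite ler_pdivrMr ?oppr_gt0//; lra.
  apply: le_lam => u fu lu; rewrite mulrAC ler_pdivrMr ?oppr_gt0//.
  (* This [t] is where the segment between [u] and [z] crosses [l = 0]; there [f] is at least [r],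
     and convexity compares the two slopes. *)
  pose t := - l z / (l u - l z).
  have D0 : 0 < l u - l z by lra.
  have tD : t * (l u - l z) = - l z by rewrite /t divfK// gt_eqF.
  have t01 : 0 <= t <= 1.
    by apply/andP; split; rewrite /t ?ler_pdivrMr ?mul1r ?divr_ge0//; lra.
  have [voo] := convex_fine u z t t01 fu fz; rewrite -/(F _) -/(F u) -/(F z).
  have := rF0 _ voo; rewrite l_cvx (_ : t * l u + _ = 0); last by lra.
  move=> /(_ erefl) H1 H2.
  have := ler_wpM2r (ltW D0) (le_trans H1 H2).
  have -> : (t * F u + (1 - t) * F z) * (l u - l z) =
      F u * (t * (l u - l z)) + F z * ((l u - l z) - t * (l u - l z)) by ring.
  by rewrite tD; lra.
(* The chain is [lam * |d|^2 <= F x - r <= inner p d <= |p| * |d|]: the slope at [x], then the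
   subgradient [p] tested at [y], then Cauchy-Schwarz. *)
rewrite normrZ (ger0_norm lam0).
have nd : 0 < `|d| by rewrite normr_gt0.
rewrite -(ler_pM2r nd) -mulrA -expr2 -lx.
apply: (le_trans (lam_le x foo_x lx0)); apply: le_trans (inner_le_norm _ ip p d).
have := ps y; rewrite -/(F x) (fE y foo_y) lee_fin Fy -(opprB x y) -/d innerNr//; lra.
Qed.

End level_descent.

(** * The equivalence of the two statements *)

Lemma inf_norm_ge1P (R : realType) (V : completeNormedModType R) (C : set V) :
  (1 <= inf_norm C)%E <-> forall p, C p -> 1 <= `|p|.
Proof.
split=> [/ereal_infP h p Cp|h].
  by rewrite -lee_fin; apply: h; exists p.
by apply/ereal_infP => _ [p Cp <-]; rewrite lee_fin h.
Qed.

Lemma classK_id (R : realType) : classK +oo%E (@idfun R).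
Proof.
have d1 (t : R) : derive1 (@idfun R) t = 1 by rewrite derive1E derive_id.
split=> //; first by apply: continuous_subspaceT => t; exact: cvg_id.
move=> t _ _; split; [exact: derivable_id| |by rewrite d1].
have -> : derive1 (@idfun R) = (fun=> 1 : R) by exact/funext.
exact: cvg_cst.
Qed.

Theorem theorem4p4 (R : realType) (V : completeNormedModType R)
  (inner : V -> V -> R) (f : V -> \bar R) :
  is_inner_product inner ->
  lower_semicontinuous f -> proper_fun f -> convex_efun f ->
  ereal_inf (range f) = 0%E ->
  (exists r0 : R, 0 < r0 /\
     exists phi : R -> R, classK r0%:E phi /\
       forall x : V, (0 < f x)%E -> (f x <= r0%:E)%E ->
         (1 <= inf_norm (frechet_subdiff inner (compK r0%:E phi f) x))%E)
  <->
  (exists psi : R -> R, classK +oo%E psi /\ concave_on_nonneg psi /\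
     forall x : V, f x <> 0%E ->
       (1 <= inf_norm (frechet_subdiff inner (compK +oo%E psi f) x))%E).
Proof.
move=> ip lsc _ cvx inf0.
have f_ge0 x : (0 <= f x)%E by rewrite -inf0; apply: ereal_inf_lbound; exists x.
have f_gt0 x : f x <> 0%E -> (0 < f x)%E.
  by move=> /eqP fx; rewrite lt_neqAle eq_sym fx f_ge0.
have below (r : R) : 0 < r -> [set z | (f z <= r%:E)%E] !=set0.
  move=> r0; have : (ereal_inf (range f) < r%:E)%E by rewrite inf0 lte_fin.
  by move=> /ereal_inf_lt[_ [z _ <-] fz]; exists z; exact: ltW.
split; last first.
  (* From (ii) to (i), [psi] serves with [r0 = 1]. A Fréchet subgradient of the truncated
     composition yields a convex subgradient of [f], hence is one of the untruncated composition
     too. *)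
  move=> [psi [K [_ H]]]; exists 1; split=> //; exists psi.
  have K1 : classK 1%:E psi.
    have [c p0 d] := K; split=> //; last by move=> t t0 _; apply: d => //; exact: ltry.
    by apply: continuous_subspaceW c => t /= [t0 _]; split=> //; exact: ltry.
  split=> // x fx0 _; apply/inf_norm_ge1P => p pP.
  have [fxfin _ qs] := subgradient_frechet_compK inner f ip f_ge0 cvx _ _ _ _ K1 fx0 pP.
  have fxoo : (f x < +oo)%E by rewrite -(fineK fxfin) ltry.
  have := frechet_subdiff_compK inner f ip f_ge0 _ _ _ _ K fx0 fxoo qs.
  have [_ _ /(_ (fine (f x)))[||_ _ d0]] := K; [|exact: ltry|].
    by rewrite -lte_fin fineK.
  rewrite scalerA mulfV ?gt_eqF// scale1r.
  have fx_neq0 : f x <> 0%E by move=> fx; rewrite fx ltxx in fx0.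
  exact: (inf_norm_ge1P _ _ _).1 (H x fx_neq0) _.
move=> [r0 [r00 [phi [K H]]]].
(* One subgradient at [x] controls the derivative of [phi] at every level [s <= fine (f x)] with
   [s < r0]; only [s < fine (f x)] requires a descent. *)
have slope x p (s : R) : (0 < f x)%E -> f x \is a fin_num -> subgradient inner f x p ->
    0 < s -> s < r0 -> s <= fine (f x) -> 1 <= derive1 phi s * `|p|.
  move=> fx0 fxfin ps s0 sr0 sfx.
  have [_ _ /(_ _ s0)] := K; rewrite lte_fin => /(_ sr0)[_ _ d0].
  have at_level y q : f y = s%:E -> subgradient inner f y q -> 1 <= derive1 phi s * `|q|.
    move=> fy qs; have fy0 : (0 < f y)%E by rewrite fy lte_fin.
    have fyr : (f y < r0%:E)%E by rewrite fy lte_fin.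
    have := frechet_subdiff_compK inner f ip f_ge0 _ _ _ _ K fy0 fyr qs.
    move=> /((inf_norm_ge1P _ _ _).1 (H y fy0 (ltW fyr))).
    by rewrite fy /= normrZ gtr0_norm.
  move: sfx; rewrite le_eqVlt => /orP[/eqP sfx|sfx].
    by apply: (at_level x) => //; rewrite sfx fineK.
  have sfx' : (s%:E < f x)%E by rewrite -(fineK fxfin) lte_fin.
  have [y [q [fy qs qp]]] :=
    subgradient_descent inner f ip f_ge0 cvx lsc x p s (below s s0) fxfin sfx' ps.
  by apply: le_trans (at_level y q fy qs) _; rewrite ler_pM2l.
(* If [f] has no subgradient at a positive level, every subdifferential in (ii) is empty and the
   identity serves as [psi]. Otherwise [p0] supplies the lower bound [|p0|^-1] for the derivative of
   [phi] up to [r1]. *)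
have [[x0 [p0 [fx0 fxfin ps]]]|noP] := pselect (exists x p,
    [/\ (0 < f x)%E, f x \is a fin_num & subgradient inner f x p]); last first.
  exists idfun; split; first exact: classK_id.
  split=> [s t l _ _ _|x /f_gt0 fx0]; first exact: lexx.
  apply/inf_norm_ge1P => p pP; exfalso; apply: noP.
  have [fxfin _ qs] :=
    subgradient_frechet_compK inner f ip f_ge0 cvx _ _ _ _ (classK_id R) fx0 pP.
  by exists x; eexists; split; [| |exact: qs].
have a0 : 0 < fine (f x0) by rewrite -lte_fin fineK.
pose r1 := Num.min (fine (f x0)) r0 / 2.
have [r10 r1r0 r1a] : [/\ 0 < r1, r1 < r0 & r1 <= fine (f x0)].
  by rewrite /r1 minEle; case: ifP => ?; split; lra.
have pos x p : (0 < f x)%E -> f x \is a fin_num -> subgradient inner f x p -> 0 < `|p|.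
  move=> fx fxf psx; have fx' : 0 < fine (f x) by rewrite -lte_fin fineK.
  have := slope x p (Num.min r1 (fine (f x))) fx fxf psx.
  rewrite lt_min r10 fx' gt_min r1r0 ge_min lexx orbT => /(_ isT isT isT).
  by rewrite normr_gt0; case: eqP => // ->; rewrite normr0 mulr0 ler10.
have [|s s0 sr1|psi [Kpsi cpsi psi_ge]] :=
    classK_concave_desingularization _ phi r0 r1 (`|p0|^-1) K r10 r1r0.
- by rewrite invr_gt0; exact: pos fx0 fxfin ps.
- rewrite -[_^-1]mul1r ler_pdivrMr; last exact: pos fx0 fxfin ps.
  by apply: slope fx0 fxfin ps s0 _ _; [exact: le_lt_trans r1r0|exact: le_trans r1a].
exists psi; split=> //; split=> // x /f_gt0 fx; apply/inf_norm_ge1P => p pP.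
have [fxf _ qs] := subgradient_frechet_compK inner f ip f_ge0 cvx _ _ _ _ Kpsi fx pP.
have fx' : 0 < fine (f x) by rewrite -lte_fin fineK.
have [_ _ /(_ _ fx' (ltry _))[_ _ d0]] := Kpsi.
have q0 := pos _ _ fx fxf qs.
(* With [q] the convex subgradient obtained from [p], [slope] shows that [k = |q|^-1] is an
   admissible bound. Hence the derivative of [psi] at [fine (f x)] is at least [|q|^-1], which says
   [1 <= |p|]. *)
have := psi_ge (fine (f x)) (`|(derive1 psi (fine (f x)))^-1 *: p|^-1) fx'.
have pE : p = derive1 psi (fine (f x)) *: ((derive1 psi (fine (f x)))^-1 *: p).
  by rewrite scalerA mulfV ?gt_eqF// scale1r.
move=> hpsi; rewrite [in X in _ <= X]pE normrZ gtr0_norm// -ler_pdivrMr// mul1r.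
apply: hpsi => s s0 sfx sr1; rewrite -[_^-1]mul1r ler_pdivrMr//.
by apply: slope fx fxf qs s0 _ sfx; exact: le_lt_trans r1r0.
Qed.
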